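(* Let $\pi:\omega\to\omega$ be an infinite-to-one function, and let $\langle S_n\mid n<\omega\rangle$ and $\langle m_n\mid n<\omega\rangle$ (with $m_n\in\omega$) be sequences such that: (i) $S_n\subseteq 2^{\leq m_n}$ for every $n$; (ii) if $n\leq m$, then $S_n=S_m\cap 2^{\leq m_n}$ (and $m_n$ is increasing in $n$); (iii) for each $n$ and each $k<m_n$, $S_n$ has at most $\pi(k)$-many nodes at level $k$; (iv) for every $n$, any node $t\in S_{n+1}\setminus S_n$ is above some maximal node of $S_n$; (v) if $n$ is even, then every maximal node of $S_n$ branches in $S_{n+1}$ (and has exactly $2$ proper extensions in $S_{n+1}$); (vi) if $n$ is odd, then: (a) none of the maximal nodes of $S_n$ branches in $S_{n+1}$ (so the part of $S_{n+1}$ above such a node forms a $\sqsubseteq$-chain); and (b) for any finite subset $F$ of the set of maximal nodes in $S_n$, there is a level $m_n\leq k<m_{n+1}$ such that $|F|=\pi(k)$ and every node in $F$ has an extension in $S_{n+1}$ at level $k$, and $\mathcal{L}_k(S_{n+1})$ consists exactly of those extensions. Let $S=\bigcup_{n<\omega}S_n$. Then the set of branches $Br(S)$ is a meager subset of $2^\omega$.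
   Context: A function $\pi:\omega\to\omega$ is infinite-to-one if $\pi^{-1}[\{n\}]$ is infinite for every $n<\omega$. $2^n$ is the set of functions $t:n\to 2$, $2^{\leq m}=\bigcup_{n\leq m}2^n$, and $2^{<\omega}=\bigcup_{n<\omega}2^n$. For sequences $s,t$, $s\sqsubseteq t$ means that $t$ extends $s$ (i.e. $t\restriction\mathrm{dom}(s)=s$); $t$ is then said to be above $s$ and to be an extension of $s$. Elements of $S\subseteq 2^{<\omega}$ are called nodes; the level of $t\in 2^n$ is $n$, and $\mathcal{L}_n(S)=S\cap 2^n$. A node of $S_n$ is maximal if it has no proper extension in $S_n$. A node branches in $S_{n+1}$ if it has two $\sqsubseteq$-incomparable extensions in $S_{n+1}$. A real $r\in 2^\omega$ is a branch through $S$ if there are infinitely many $n$ such that $r\restriction n\in\mathcal{L}_n(S)$, and $Br(S)=\{r\in 2^\omega\mid r\text{ is a branch through }S\}$. The space $2^\omega$ carries the product topology generated by the cylinders $C_t=\{f\in 2^\omega\mid t\sqsubseteq f\}$, $t\in 2^{<\omega}$; a set is meager if it is a countable union of nowhere dense sets. *)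

(* Defs.v *)
From mathcomp Require Import all_boot.
From mathcomp Require Import all_classical.
From mathcomp Require Import topology cantor.

Set Implicit Arguments.
Unset Strict Implicit.
Unset Printing Implicit Defensive.

Local Open Scope classical_set_scope.

Definition infinite_to_one (pi : nat -> nat) : Prop :=
  forall n, infinite_set (pi @^-1` [set n]).

(* The function t : n -> 2 is encoded as the list [:: t 0; ...; t (n - 1)], so
   that dom(t) is [size t] and the extension order is [prefix]. *)
Definition node : Type := seq bool.

Definition level (n : nat) (S : set node) : set node :=
  [set t | S t /\ size t = n].

Definition nodes_upto (m : nat) : set node := [set t | (size t <= m)%N].

Definition extensions (S : set node) (t : node) : set node :=
  [set u | S u /\ prefix t u].

Definition proper_extensions (S : set node) (t : node) : set node :=
  [set u | extensions S t u /\ u <> t].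

Definition maximal_nodes (S : set node) : set node :=
  [set t | S t /\ proper_extensions S t = set0].

Definition incomparable (u v : node) : Prop := ~ prefix u v /\ ~ prefix v u.

Definition branches_in (S : set node) (t : node) : Prop :=
  exists u v, [/\ extensions S t u, extensions S t v & incomparable u v].

Definition restr (r : cantor_space) (n : nat) : node := mkseq r n.

Definition Br (S : set node) : set cantor_space :=
  [set r | infinite_set [set n | level n S (restr r n)]].

Definition nowhere_dense (T : topologicalType) (A : set T) : Prop :=
  interior (closure A) = set0.

Definition meager (T : topologicalType) (A : set T) : Prop :=
  exists F : nat -> set T,
    (forall n, nowhere_dense (F n)) /\ A = \bigcup_n F n.

(* Main.v *)
Require Import Defs.
From mathcomp Require Import all_boot.
From mathcomp Require Import all_classical.
From mathcomp Require Import topology cantor.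

Local Open Scope classical_set_scope.
Local Open Scope card_scope.

(** The set of branches is not only meager but nowhere dense.

    Every node added after stage [n] lies above a maximal node of [S n]
    ([maximal_prefix]), so every branch passes through a maximal node of each
    [S n], and these nodes can be chosen arbitrarily long along a given branch
    ([branch_long_maximal]).  Hence a cylinder that meets the set of branches
    contains the cylinder of some maximal node [t] of [S n] with [n] odd.

    At the even stage before it some node has branched, so [S n] has a maximal
    node [t'] other than [t].  The odd stage provides a level for the finite
    set [{t}] and a level for [{t, t'}], where [pi] takes the values 1 and 2.
    They are distinct and both at least [m n], so one of them is above [m n],
    and there [t] has an extension, necessarily proper ([odd_stage_grows]).
    Since [t] does not branch in [S n.+1], every branch through [t] has to
    follow that extension ([branch_follows_extension]); flipping its first bit
    beyond [t] gives a subcylinder that contains no branch, which is what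
    nowhere density asks for ([nowhere_dense_cylinder]). *)

(** * Prefixes and cylinders *)

Lemma prefix_comparable {u v w : node} :
  prefix u w -> prefix v w -> size u <= size v -> prefix u v.
Proof.
rewrite !prefixE => /eqP uw /eqP vw uv.
by rewrite -vw take_takel // uw.
Qed.

Definition cylinder (t : node) : set cantor_space :=
  [set r | restr r (size t) = t].

Lemma size_restr r n : size (restr r n) = n.
Proof. exact: size_mkseq. Qed.

Lemma cylinder_restr r n : cylinder (restr r n) r.
Proof. by rewrite /cylinder /= size_restr. Qed.

Lemma take_restr r k n : k <= n -> take k (restr r n) = restr r k.
Proof.
by move=> kn; rewrite /restr /mkseq -map_take take_iota (minn_idPl kn).
Qed.

Lemma cylinder_prefix {r t u} :
  cylinder t r -> cylinder u r -> size t <= size u -> prefix t u.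
Proof.
rewrite /cylinder /= => tr ur tu.
by rewrite prefixE -ur take_restr // tr.
Qed.

Lemma cylinder_sub {s t} : prefix s t -> cylinder t `<=` cylinder s.
Proof.
move=> st r tr; have ss := size_prefix st.
by move: st; rewrite /cylinder /= prefixE -tr take_restr // => /eqP.
Qed.

Lemma cylinder_nonempty t : cylinder t !=set0.
Proof. by exists (nth false t); rewrite /cylinder /= /restr mkseq_nth. Qed.

Lemma open_cylinder t : open (cylinder t).
Proof.
have -> : cylinder t =
    \bigcap_(i in `I_(size t)) (proj i @^-1` [set nth false t i]).
  apply/seteqP; split => r /=.
    by move=> tr i /= it; rewrite /= /proj -[in RHS]tr nth_mkseq.
  move=> tr; apply: (@eq_from_nth _ false); rewrite size_restr // => i it.
  by rewrite nth_mkseq //; exact: tr.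
rewrite bigcap_mkord; elim/big_ind: _ => [|A B oA oB|i _].
- exact: openT.
- exact: openI.
- by apply: open_comp => [r _|]; [exact: proj_continuous|exact: discrete_open].
Qed.

(** The filter generated by the cylinders of [r] converges to [r], because it
    converges coordinatewise. *)
Lemma nbhs_cylinder (r : cantor_space) U :
  nbhs r U -> exists n, cylinder (restr r n) `<=` U.
Proof.
pose F := filter_from [set: nat] (fun n => cylinder (restr r n)).
have FF : Filter F.
  apply: filter_from_filter; first by exists 0.
  move=> i j _ _; exists (maxn i j) => // x xr.
  by split; apply: cylinder_sub xr;
    apply: cylinder_prefix (cylinder_restr r _) (cylinder_restr r _) _;
    rewrite !size_restr ?leq_maxl ?leq_maxr.
suff Fr : F --> r by move=> /Fr[n _ nU]; exists n.
apply/cvg_sup => i V [_ [[W oW <-] Wr] WV].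
exists i.+1 => // x xr; apply: WV.
have /(congr1 (fun s => nth false s i)) := xr.
by rewrite size_restr !nth_mkseq //= => xri; move: Wr; rewrite /= /proj xri.
Qed.

Lemma nowhere_dense_cylinder (A : set cantor_space) :
  (forall s, exists2 t, prefix s t & cylinder t `&` A = set0) ->
  nowhere_dense A.
Proof.
move=> avoid; apply/seteqP; split => // r /nbhs_cylinder[n rA].
have [t st tA] := avoid (restr r n); have [x tx] := cylinder_nonempty t.
have /(_ (cylinder t)) := rA x (cylinder_sub st _ tx).
case; first by apply: open_nbhs_nbhs; split => //; exact: open_cylinder.
by move=> y [Ay ty]; have : (cylinder t `&` A) y by []; rewrite tA.
Qed.

(** * Maximal nodes *)

Lemma maximal_ext_eq {S s u} :
  maximal_nodes S s -> S u -> prefix s u -> u = s.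
Proof.
move=> [_ smax] Su su; apply: contrapT => us.
by have : proper_extensions S s u by []; rewrite smax.
Qed.

Lemma exists_maximal_ext {S M t} : S `<=` nodes_upto M -> S t ->
  exists2 u, maximal_nodes S u & prefix t u.
Proof.
move=> SM; have [d] := ubnP (M - size t); elim: d t => // d IH t td St.
have [tmax|/set0P[u [[Su tu] ut]]] := eqVneq (proper_extensions S t) set0.
  by exists t => //; exact: prefix_refl.
have lt_tu : size t < size u.
  rewrite ltn_neqAle size_prefix // andbT; apply/eqP => eqs; apply: ut.
  by move: tu; rewrite prefixE eqs take_size => /eqP.
have [|//|v vmax uv] := IH u.
  have uM := SM _ Su; rewrite ltnS in td.
  by apply: leq_trans td; apply: ltn_sub2l => //; exact: leq_trans lt_tu uM.
by exists v => //; exact: prefix_trans uv.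
Qed.

(** Two incomparable nodes cannot have a common extension, so they yield two
    distinct maximal nodes. *)
Lemma branches_in_other_maximal {S M s} : S `<=` nodes_upto M ->
  branches_in S s -> forall t, exists2 t', maximal_nodes S t' & t' <> t.
Proof.
move=> SM [u [v [[Su _] [Sv _] [nuv nvu]]]] t.
have [u' u'max uu'] := exists_maximal_ext SM Su.
have [v' v'max vv'] := exists_maximal_ext SM Sv.
have [u't|] := pselect (u' = t); last by exists u'.
exists v' => // v't; rewrite v't -u't in vv'.
case/orP: (leq_total (size u) (size v)) => uv.
  by apply: nuv; exact: prefix_comparable uu' vv' uv.
by apply: nvu; exact: prefix_comparable vv' uu' uv.
Qed.

(** * Branches through the growing sequence of trees *)

Lemma stage_subset {S : nat -> set node} {m : nat -> nat} :
  (forall n k, n <= k -> S n = S k `&` nodes_upto (m n)) ->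
  forall n k, n <= k -> S n `<=` S k.
Proof. by move=> h2 n k /h2 -> t []. Qed.

(** By induction on the later stage [k]: the maximal node of [S k] below [t]
    either already belongs to [S n], where it is then maximal as well, or was
    added after stage [n] and the induction hypothesis applies to it. *)
Lemma maximal_prefix {S : nat -> set node} {m : nat -> nat} :
  (forall n k, n <= k -> S n = S k `&` nodes_upto (m n)) ->
  (forall n t, (S n.+1 `\` S n) t ->
     exists s, maximal_nodes (S n) s /\ prefix s t) ->
  forall n k t, n <= k -> S k t -> ~ S n t ->
  exists2 s, maximal_nodes (S n) s & prefix s t.
Proof.
move=> h2 h4 n k t; elim: k t => [|k IH] t.
  by rewrite leqn0 => /eqP <-.
rewrite leq_eqVlt => /predU1P[<-//|nk] Skt nSnt.
have [Skt'|nSkt] := pselect (S k t); first exact: IH.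
have [s [smax st]] := h4 _ _ (conj Skt nSkt).
have [Sns|nSns] := pselect (S n s).
  exists s => //; split => //; apply/seteqP; split => // u [[Snu su] us].
  by apply/us/(maximal_ext_eq smax) => //; exact: stage_subset h2 n k nk _ Snu.
have [s' s'max s's] := IH s nk (proj1 smax) nSns.
by exists s' => //; exact: prefix_trans st.
Qed.

Lemma Br_unbounded {S r} : Br S r ->
  forall n, exists2 j, n <= j & S (restr r j).
Proof.
move=> Brr n; apply: contrapT => none; apply: Brr.
apply: (@sub_finite_set _ _ `I_n); last exact: finite_II.
move=> j [Srj _] /=; rewrite ltnNge; apply/negP => nj.
by apply: none; exists j.
Qed.

Lemma branch_maximal {S : nat -> set node} {m : nat -> nat} :
  (forall n, S n `<=` nodes_upto (m n)) ->
  (forall n k, n <= k -> S n = S k `&` nodes_upto (m n)) ->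
  (forall n t, (S n.+1 `\` S n) t ->
     exists s, maximal_nodes (S n) s /\ prefix s t) ->
  forall r n, Br (\bigcup_n S n) r ->
  exists2 s, maximal_nodes (S n) s & cylinder s r.
Proof.
move=> h1 h2 h4 r n /Br_unbounded/(_ (m n).+1)[j mj [k _ Skj]].
have nSn l : l <= n -> ~ S l (restr r j).
  move=> /(stage_subset h2)/[apply]/h1.
  by rewrite /nodes_upto /= size_restr leqNgt mj.
have nk : n <= k.
  by rewrite leqNgt; apply/negP => kn; exact: nSn (ltnW kn) Skj.
have [s smax sr] := maximal_prefix h2 h4 n k _ nk Skj (nSn n (leqnn n)).
by exists s => //; apply: cylinder_sub sr _ _; exact: cylinder_restr.
Qed.

(** Once the branch has a node of length at least [l] in [S n], the maximal
    node of [S n] on the branch cannot be shorter. *)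
Lemma branch_long_maximal {S : nat -> set node} {m : nat -> nat} :
  (forall n, S n `<=` nodes_upto (m n)) ->
  (forall n k, n <= k -> S n = S k `&` nodes_upto (m n)) ->
  (forall n t, (S n.+1 `\` S n) t ->
     exists s, maximal_nodes (S n) s /\ prefix s t) ->
  forall r l, Br (\bigcup_n S n) r ->
  exists n t, [/\ odd n, maximal_nodes (S n) t, cylinder t r & l <= size t].
Proof.
move=> h1 h2 h4 r l Brr; have [j lj [k _ Skj]] := Br_unbounded Brr l.
have [t tmax tr] := branch_maximal h1 h2 h4 r k.*2.+1 Brr.
exists k.*2.+1, t; split => //; first by rewrite /= odd_double.
rewrite leqNgt; apply/negP => tl.
have /(maximal_ext_eq tmax) jt : S k.*2.+1 (restr r j).
  apply: (stage_subset h2 k) Skj; rewrite -addnn.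
  exact: leqW (leq_addr k k).
have tj : size t < j := leq_trans tl lj.
have tpre : prefix t (restr r j).
  by apply: cylinder_prefix tr (cylinder_restr r j) _; rewrite size_restr ltnW.
by move: tj; rewrite -(jt tpre) size_restr ltnn.
Qed.

(** The levels given for [{t}] and [{t, t'}] have different values of [width],
    so they cannot both be the lowest admissible level [M]; on a higher level
    an extension of [t] is longer than [t]. *)
Lemma odd_stage_grows {width : nat -> nat} {A B : set node} {M N : nat}
    {t t' : node} :
  A `<=` nodes_upto M ->
  (forall F : set node, finite_set F -> F `<=` maximal_nodes A ->
     exists k, [/\ M <= k < N,
       F #= `I_(width k),
       forall t, F t -> exists u, level k B u /\ prefix t u &
       level k B =
         [set u | level k B u /\ exists2 t, F t & prefix t u]]) ->
  maximal_nodes A t -> maximal_nodes A t' -> t' <> t ->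
  exists2 u, proper_extensions B t u & size t < size u.
Proof.
move=> AM h6 tmax t'max t't.
have [||k1 [/andP[Mk1 _] c1 ext1 _]] := h6 [set t].
- exact: finite_set1.
- by move=> _ ->.
have [||k2 [/andP[Mk2 _] c2 ext2 _]] := h6 [set t; t'].
- by rewrite finite_setU; split; exact: finite_set1.
- by move=> _ [] ->.
have k12 : k1 != k2.
  apply/eqP => k12; rewrite -k12 -(card_eqr c1) (card_eqr card_set1) in c2.
  have /card_set_bijP[f [fI finj _]] := c2.
  apply: t't; apply: finj; rewrite ?inE; [by right|by left|].
  have I1 x : [set t; t'] x -> f x = 0.
    by move=> /fI /=; rewrite ltnS leqn0 => /eqP.
  by rewrite !I1; [|left|right].
have grow k u : M < k -> level k B u -> prefix t u ->
    exists2 u, proper_extensions B t u & size t < size u.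
  move=> Mk [Bu uk] tu.
  have tu' : size t < size u.
    by rewrite uk; apply: leq_ltn_trans Mk; apply: AM; case: tmax.
  by exists u => //; split => // ut; rewrite ut ltnn in tu'.
have [u1 [lu1 tu1]] := ext1 t erefl.
have [u2 [lu2 tu2]] := ext2 t (or_introl erefl).
have [Mk|] := ltnP M k1; first exact: grow lu1 tu1.
rewrite leq_eqVlt ltnNge Mk1 orbF => /eqP k1M.
by apply: grow lu2 tu2; rewrite ltn_neqAle -k1M k12 k1M.
Qed.

(** As [t] does not branch, [u] is comparable with the maximal node [s] on the
    branch [r], and maximality leaves only the case where [s] extends [u]. *)
Lemma branch_follows_extension {A : set node} {s t u r} :
  A t -> ~ branches_in A t -> extensions A t u ->
  maximal_nodes A s -> cylinder s r -> cylinder t r -> cylinder u r.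
Proof.
move=> At nbr [Au tu] smax sr tr; have As : A s by case: smax.
have [st|ts] := leqP (size s) (size t).
  have ts := maximal_ext_eq smax At (cylinder_prefix sr tr st).
  by rewrite (maximal_ext_eq smax Au) // -ts.
have ts' := cylinder_prefix tr sr (ltnW ts).
have [us|nus] := pselect (prefix u s); first exact: cylinder_sub us _ sr.
have [su|nsu] := pselect (prefix s u).
  by rewrite (maximal_ext_eq smax Au).
by case: nbr; exists u, s.
Qed.

Theorem theorem2p11 (pi : nat -> nat) (S : nat -> set node) (m : nat -> nat)
  (hpi : infinite_to_one pi)
  (h1 : forall n, S n `<=` nodes_upto (m n))
  (h2 : forall n k, (n <= k)%N -> S n = S k `&` nodes_upto (m n))
  (h2' : forall n k, (n < k)%N -> (m n < m k)%N)
  (h3 : forall n k, (k < m n)%N -> level k (S n) #<= `I_(pi k))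
  (h4 : forall n t, (S n.+1 `\` S n) t ->
     exists s, maximal_nodes (S n) s /\ prefix s t)
  (h5 : forall n, ~~ odd n -> forall t, maximal_nodes (S n) t ->
     branches_in (S n.+1) t /\ proper_extensions (S n.+1) t #= `I_2)
  (h6a : forall n, odd n -> forall t, maximal_nodes (S n) t ->
     ~ branches_in (S n.+1) t)
  (h6b : forall n, odd n -> forall F : set node,
     finite_set F -> F `<=` maximal_nodes (S n) ->
     exists k, [/\ (m n <= k < m n.+1)%N,
       F #= `I_(pi k),
       forall t, F t -> exists u, level k (S n.+1) u /\ prefix t u &
       level k (S n.+1) =
         [set u | level k (S n.+1) u /\ exists2 t, F t & prefix t u]]) :
  meager (Br (\bigcup_n S n)).
Proof.
exists (fun=> Br (\bigcup_n S n)); split; last by rewrite bigcup_const.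
move=> _; apply: nowhere_dense_cylinder => s.
have [miss|/set0P[r [sr Brr]]] :=
  eqVneq (cylinder s `&` Br (\bigcup_n S n)) set0.
  by exists s => //; exact: prefix_refl.
have [n [t [on tmax tr st]]] := branch_long_maximal h1 h2 h4 r (size s) Brr.
case: n on tmax => // n /= on tmax.
have [p pmax _] := branch_maximal h1 h2 h4 r n Brr.
have [t' t'max t't] :=
  branches_in_other_maximal (h1 n.+1) (h5 n on p pmax).1 t.
have [u [uext _] tu] := odd_stage_grows (h1 n.+1) (h6b n.+1 on) tmax t'max t't.
have [w wE] : exists w, u = t ++ w by apply/prefixP; case: uext.
case: w wE => [|b w] wE; first by rewrite wE cats0 ltnn in tu.
exists (rcons t (~~ b)).
  exact: prefix_trans (cylinder_prefix sr tr st) (prefix_rcons _ _).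
apply/seteqP; split => // x [bx Brx].
have tx : cylinder t x := cylinder_sub (prefix_rcons _ _) _ bx.
have [v vmax vx] := branch_maximal h1 h2 h4 x n.+2 Brx.
have ux : cylinder u x.
  apply: branch_follows_extension (h6a n.+1 on t tmax) uext vmax vx tx.
  by apply: (stage_subset h2 n.+1) => //; case: tmax.
have := cylinder_prefix bx ux; rewrite size_rcons => /(_ tu).
by rewrite wE -cats1 prefix_catr // eqxx /= prefix0s andbT; case: (b).
Qed.
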